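(* Let $k\ge 3$ and $n\ge 2$ be integers and let $d(k)=(2k+1)^{8k+4}k^2(k+1)$. Let $G$ be a graph and let $(H,\sigma)$ be a $k$-system of magnitude at least $d(k)n$ in $G$. Then $G$ contains $S_{n,k}$ as a strong immersion respecting $(H,\sigma)$; that is, there is a strong immersion $\theta$ of $S_{n,k}$ in $G$ with $\theta(c(S_{n,k}))=\sigma(c(H))$ and $\theta(R(S_{n,k}))\subseteq\sigma(R(H))$.
   Context: Graphs are finite and may have parallel edges and loops; each loop contributes $2$ to the degree of its vertex. Immersions. An immersion of a graph $H$ in a graph $G$ is a function $\theta$ on the vertices and edges of $H$ such that: (a) $\theta(v)$ is a vertex of $G$ for each $v\in V(H)$, and $\theta$ restricted to $V(H)$ is injective; (b) $\theta(e)$ is a connected subgraph of $G$ for each $e\in E(H)$, and for distinct $e,f\in E(H)$ the subgraphs $\theta(e)$ and $\theta(f)$ are edge-disjoint; (c) if $e\in E(H)$ is incident with $v\in V(H)$, then $\theta(v)$ is a vertex of $\theta(e)$, and if $e$ is a loop, then $\theta(e)$ contains a cycle passing through $\theta(v)$. The immersion is strong if, in addition, whenever $e\in E(H)$ is not incident with $v\in V(H)$, $\theta(e)$ does not contain $\theta(v)$. Multistars. A multistar is a connected loopless graph $H$ with at least three vertices that contains a vertex incident with all its edges; this vertex is the center $c(H)$, and all other vertices are rays, forming the set $R(H)$. $S_{n,k}$ denotes the multistar with $n$ rays, each of degree $k$. $k$-systems. A $k$-system of magnitude $d$ in a graph $G$ is a pair $(H,\sigma)$, where $H$ is a multistar and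 $\sigma$ is a strong immersion of $H$ in $G$, such that: $H$ has at least $d$ edges; every ray of $H$ has degree at most $k$ in $H$; and for each $v\in R(H)$ there is no edge cut in $G$ of size less than $k$ separating $\sigma(c(H))$ from $\sigma(v)$. *)

(* Defs.v *)
From mathcomp Require Import all_boot.

Set Implicit Arguments.
Unset Strict Implicit.
Unset Printing Implicit Defensive.

(* Finite undirected multigraphs.  The two ends of an edge are listed in an
   arbitrary order; every notion below is symmetric in [end1] and [end2].  A
   loop has [end1 e = end2 e]; distinct edges with the same ends are parallel. *)
Record mgraph := MGraph {
  vertex :> finType;
  edge : finType;
  end1 : edge -> vertex;
  end2 : edge -> vertex
}.

Definition incident (G : mgraph) (v : G) (e : edge G) : bool :=
  (v == end1 e) || (v == end2 e).

Definition is_loop (G : mgraph) (e : edge G) : bool := end1 e == end2 e.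

Record subgraph (G : mgraph) := Subgraph {
  sverts : {set G};
  sedges : {set edge G};
  sends : [forall e in sedges, (end1 e \in sverts) && (end2 e \in sverts)]
}.

Lemma full_sends (G : mgraph) :
  [forall e in [set: edge G],
     (end1 e \in [set: G]) && (end2 e \in [set: G])].
Proof. by apply/forall_inP => e _; rewrite !inE. Qed.

Definition full (G : mgraph) : subgraph G := Subgraph (full_sends G).

Definition is_subgraph (G : mgraph) (C D : subgraph G) : bool :=
  (sverts C \subset sverts D) && (sedges C \subset sedges D).

(* Each loop at [v] contributes 2. *)
Definition sdegree (G : mgraph) (D : subgraph G) (v : G) : nat :=
  \sum_(e in sedges D) ((v == end1 e) + (v == end2 e)).

Definition degree (G : mgraph) (v : G) : nat := sdegree (full G) v.

Definition sadj (G : mgraph) (D : subgraph G) : rel G :=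
  fun x y => [exists e in sedges D,
    ((x == end1 e) && (y == end2 e)) || ((x == end2 e) && (y == end1 e))].

Definition sconnected (G : mgraph) (D : subgraph G) : Prop :=
  sverts D != set0 /\
  forall x y, x \in sverts D -> y \in sverts D -> connect (sadj D) x y.

Definition connected (G : mgraph) : Prop := sconnected (full G).

(* A loop and a pair of parallel edges are cycles of length 1 and 2. *)
Definition is_cycle (G : mgraph) (C : subgraph G) : Prop :=
  sconnected C /\ forall v, v \in sverts C -> sdegree C v = 2.

Record im_map (H G : mgraph) := ImMap {
  im_vert :> H -> G;
  im_edge : edge H -> subgraph G
}.

Definition is_immersion (H G : mgraph) (theta : im_map H G) : Prop :=
  [/\ injective (im_vert theta),
      forall e, sconnected (im_edge theta e),
      forall e f, e != f ->
        [disjoint sedges (im_edge theta e) & sedges (im_edge theta f)],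
      forall e v, incident v e -> theta v \in sverts (im_edge theta e)
    & forall e v, incident v e -> is_loop e ->
        exists C : subgraph G,
          [/\ is_subgraph C (im_edge theta e), is_cycle C & theta v \in sverts C]].

Definition is_strong_immersion (H G : mgraph) (theta : im_map H G) : Prop :=
  is_immersion theta /\
  forall e v, ~~ incident v e -> theta v \notin sverts (im_edge theta e).

Definition is_multistar (H : mgraph) (c : H) : Prop :=
  [/\ connected H, forall e : edge H, ~~ is_loop e, 3 <= #|H|
    & forall e : edge H, incident c e].

Definition rays (H : mgraph) (c : H) : {set H} := [set~ c].

Lemma multistar_center_uniq (H : mgraph) (c c' : H) :
  is_multistar c -> is_multistar c' -> c = c'.
Proof.
move=> [[_ conH] _ card3 incc] [_ _ _ incc']; apply/eqP/negPn/negP => ncc.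
have eP : forall e x, incident x e -> (x == c) || (x == c').
  move=> e x /orP[] /eqP ->; move: (incc e) (incc' e); rewrite /incident
    => /orP[] /eqP cE /orP[] /eqP c'E; rewrite -?cE -?c'E ?eqxx ?orbT //;
    by move: ncc; rewrite cE c'E eqxx.
have: 2 < #|[set: H]| by rewrite cardsT.
have sub: [set: H] \subset [set c; c'].
  apply/subsetP => x _; rewrite !inE.
  case/connectP: (conH x c (in_setT _) (in_setT _)) => [[|y p]] /= pth lst.
    by rewrite lst eqxx.
  have /andP[/existsP[e /andP[_ xye]] _] := pth.
  apply: (eP e); rewrite /incident.
  by case/orP: xye => /andP[-> _]; rewrite ?orbT.
by move=> /leq_trans /(_ (subset_leq_card sub)); rewrite cards2 ncc.
Qed.

(* The multistar with [n] rays, each joined to the center [None] by [k]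
   parallel edges. *)
Definition star (n k : nat) : mgraph :=
  @MGraph (option 'I_n) ('I_n * 'I_k)%type (fun _ => None) (fun e => Some e.1).

Definition star_center (n k : nat) : star n k := None.

Lemma star_multistar (n k : nat) :
  1 < n -> 0 < k -> is_multistar (star_center n k).
Proof.
move=> n1 k0; split => //; last by rewrite card_option card_ord ltnS.
have cx (x : star n k) : connect (sadj (full (star n k))) None x.
  case: x => [i|]; last exact: connect0.
  by apply: connect1; apply/existsP; exists (i, Ordinal k0); rewrite !inE !eqxx.
have symc : symmetric (sadj (full (star n k))).
  by move=> x y; apply: eq_existsb => e; rewrite orbC [X in X || _]andbC
    [X in _ || X]andbC.
split; first by apply/set0Pn; exists None; rewrite inE.
move=> x y _ _; apply: connect_trans (cx y).
by rewrite (sym_connect_sym symc).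
Qed.

Lemma star_rays (n k : nat) : #|rays (star_center n k)| = n.
Proof. by rewrite cardsC1 card_option card_ord. Qed.

Lemma star_degree (n k : nat) (v : star n k) :
  v \in rays (star_center n k) -> degree v = k.
Proof.
case: v => [i|]; last by rewrite !inE.
move=> _; rewrite /degree /sdegree.
transitivity (\sum_(j < n) \sum_(l < k) (i == j : nat)).
  by rewrite pair_big; apply: eq_big => e; rewrite ?inE.
rewrite (bigD1 i) //= [X in _ + X]big1.
  by rewrite eqxx sum_nat_const card_ord muln1 addn0.
by move=> j ji; rewrite big1 // => _ _; rewrite eq_sym (negbTE ji).
Qed.

Definition edge_cut (G : mgraph) (X : {set G}) : {set edge G} :=
  [set e | (end1 e \in X) != (end2 e \in X)].

Definition is_ksystem (k d : nat) (G H : mgraph) (c : H) (sigma : im_map H G)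
    : Prop :=
  [/\ is_multistar c,
      is_strong_immersion sigma,
      d <= #|edge H|,
      forall v, v \in rays c -> degree v <= k
    & forall v, v \in rays c ->
        ~ exists X : {set G},
            [/\ sigma c \in X, sigma v \notin X & #|edge_cut X| < k]].

Definition dk (k : nat) : nat := (2 * k + 1) ^ (8 * k + 4) * k ^ 2 * (k + 1).

(* Main.v *)
Require Import Defs.
From mathcomp Require Import all_boot all_order all_algebra.
From mathcomp Require Import zify lra.

Set Implicit Arguments.
Unset Strict Implicit.
Unset Printing Implicit Defensive.

(* Let [s] be the image of the center and [T] the set of images of the rays.
   By Menger's theorem it suffices to find [n] elements [A] of [T] such that
   every set [X] of vertices avoiding [s] sends at least [k * |A ∩ X|] edges to
   vertices outside [X ∪ A].  One may assume [X] connected.  If [X] contains a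
   single element of [A] and is adjacent to no other, this is the cut condition
   of the k-system.  Otherwise let [B] be the set of vertices of [A] adjacent to
   [X]: a violating [X] gives a cut of size less than [k * |(A ∩ X) ∪ B|], where
   stopping at a vertex of [B] costs [k], and pushing it away from [A ∩ X] gives
   an important cut with at least as many elements of [A] on its near side.  At
   most [4 ^ c] important cuts of size [c] start at a given vertex and, by the
   edge-disjoint images of the edges of [H], each has at most [c] elements of
   [T] on its near side.  Hence if [T] is coloured at random with [256 ^ k]
   colours, a given vertex has with probability at most 1/2 an important cut of
   size [c] whose near side meets its colour class in more than [c / k], and at
   least two, vertices; what remains of a large colour class is a set [A] as
   required. *)

(** * Arc-disjoint walks *)

Section Digraph.
Variables (V R : finType) (tl hd : R -> V).
Implicit Types (D : {set R}) (X Y Z S : {set V}) (z : V).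

Definition outs D X := [set r in D | (tl r \in X) && (hd r \notin X)].

Lemma card_outs D X :
  #|outs D X| = \sum_(r in D) ((tl r \in X) && (hd r \notin X)).
Proof.
rewrite -sum1_card big_mkcond [RHS]big_mkcond; apply: eq_bigr => r _.
by rewrite !inE; case: (r \in D) => //=; case: (_ && _).
Qed.

Lemma outs_submod D X Y :
  #|outs D (X :&: Y)| + #|outs D (X :|: Y)| <= #|outs D X| + #|outs D Y|.
Proof.
rewrite !card_outs -!big_split /=; apply: leq_sum => r _; rewrite !inE.
by do 2![case: (tl r \in _)]; do 2![case: (hd r \in _)].
Qed.

(** The arc [r] leaves [X] but neither [X :&: Y] nor [X :|: Y]. *)
Lemma outs_submod_cross D X Y r : r \in D ->
    tl r \in X :\: Y -> hd r \in Y :\: X ->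
  #|outs D (X :&: Y)| + #|outs D (X :|: Y)| < #|outs D X| + #|outs D Y|.
Proof.
rewrite !inE => rD /andP[tY tX] /andP[hX hY].
rewrite !card_outs -!big_split /= !(bigD1 r rD) /= -addSn.
apply: leq_add; first by rewrite !inE tX (negbTE tY) hY (negbTE hX).
apply: leq_sum => u _; rewrite !inE.
by do 2![case: (tl u \in _)]; do 2![case: (hd u \in _)].
Qed.

Lemma outs_del D X r : r \in outs D X -> #|outs D X| = #|outs (D :\ r) X|.+1.
Proof.
move=> rX; rewrite (cardsD1 r) rX add1n; congr _.+1.
by apply: eq_card => u; rewrite !inE; case: (u == r).
Qed.

Lemma outs_del_id D X r : r \notin outs D X -> outs (D :\ r) X = outs D X.
Proof.
move=> rX; apply/setP => u; rewrite !inE; case: eqVneq => // ->.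
by move: rX; rewrite inE => /negbTE ->.
Qed.

Fixpoint walk x (w : seq R) y :=
  if w is r :: w' then (tl r == x) && walk (hd r) w' y else x == y.

Section Linkage.
Variables (I : finType) (z : V).

(** The cut condition of Menger's theorem for sending one unit from each [p i] to the sink [z] along
    arc-disjoint walks. Several units may share a start. *)
Definition hall D (p : I -> V) := forall X, z \notin X ->
  #|[set i | p i \in X]| <= #|outs D X|.

Lemma card_starts_mod (p : I -> V) X Y :
  #|[set i | p i \in X :&: Y]| + #|[set i | p i \in X :|: Y]|
    = #|[set i | p i \in X]| + #|[set i | p i \in Y]|.
Proof.
rewrite -[RHS]cardsUI addnC; congr (_ + _);
by apply: eq_card => i; rewrite !inE.
Qed.

(** Uncrossing: cut sizes are submodular, start counts are modular, and [X :&: Y] satisfies Hall's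
    condition. *)
Lemma tightU D p X Y : hall D p -> z \notin X -> z \notin Y ->
    #|outs D X| <= #|[set i | p i \in X]| ->
    #|outs D Y| <= #|[set i | p i \in Y]| ->
  #|outs D (X :|: Y)| <= #|[set i | p i \in X :|: Y]|.
Proof.
move=> hDp zX zY tX tY.
have zI : z \notin X :&: Y by rewrite inE (negbTE zX).
rewrite -(leq_add2l #|outs D (X :&: Y)|).
apply: leq_trans (outs_submod D X Y) _; apply: leq_trans (leq_add tX tY) _.
by rewrite -card_starts_mod leq_add2r hDp.
Qed.

(* A unit waiting at [x != z] can be moved along some arc of [D], which is then
   deleted: the union [X] of the tight sets avoiding [x] is tight, and if every
   arc leaving [x] entered [X], then [x |: X] would violate Hall's condition. *)
Lemma hall_step D p i : hall D p -> p i != z ->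
  exists2 r, (r \in D) && (tl r == p i) &
    hall (D :\ r) (fun j => if j == i then hd r else p j).
Proof.
move=> hDp piz; set x := p i.
pose tight := [pred X : {set V} | [&& z \notin X, x \notin X &
  #|outs D X| <= #|[set j | p j \in X]|]].
pose X := \bigcup_(Y | tight Y) Y.
have /and3P[zX xX tX] : tight X.
  rewrite /X; elim/big_ind: _ => // [|Y Z /and3P[zY xY tY] /and3P[zZ xZ tZ]].
    rewrite /= !inE /= (_ : outs D set0 = set0) ?cards0 //.
    by apply/setP => r; rewrite !inE andbF.
  by rewrite /= !inE negb_or zY zZ negb_or xY xZ /=; exact: tightU.
have [/existsP[r /and3P[rD rx hX]]|] :=
    boolP [exists r, [&& r \in D, tl r == x & hd r \notin X]]; last first.
  rewrite negb_exists => /forallP noarc.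
  have zxX : z \notin x |: X by rewrite !inE negb_or eq_sym piz zX.
  have := hDp _ zxX; rewrite leqNgt => /negP[].
  apply: leq_ltn_trans (_ : #|outs D X| < _).
    apply/subset_leq_card/subsetP => r; rewrite !inE negb_or.
    case/and3P=> rD + /andP[hx hX]; rewrite rD hX andbT /=.
    by case: eqP => //= tx _; have := noarc r; rewrite rD tx eqxx hX.
  apply: leq_ltn_trans tX _; apply: proper_card; apply/properP; split.
    by apply/subsetP => j; rewrite !inE => ->; rewrite orbT.
  by exists i; rewrite inE ?(negbTE xX) // setU11.
exists r; first by rewrite rD.
move=> Y zY.
have rx' : tl r = x by apply/eqP.
have pstart : #|[set j | (if j == i then hd r else p j) \in Y]| + (x \in Y)
    = #|[set j | p j \in Y]| + (hd r \in Y).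
  set A1 := finset _; set A2 := finset _.
  have eA : A1 :\ i = A2 :\ i by apply/setP => j; rewrite !inE; case: eqP.
  rewrite (cardsD1 i A1) (cardsD1 i A2) eA !inE eqxx -/x.
  by rewrite addnAC [RHS]addnAC (addnC (hd r \in Y : nat)).
(* Only the third case depends on the choice of [r]: a tight [Y] avoiding [x] lies in [X], which
   does not contain [hd r]. *)
have [xY|xY] := boolP (x \in Y); have [hY|hY] := boolP (hd r \in Y).
- rewrite outs_del_id; last by rewrite inE hY !andbF.
  by move: pstart; rewrite xY hY => /addIn->; apply: hDp.
- have rY : r \in outs D Y by rewrite inE rD rx' xY hY.
  move: pstart; rewrite xY (negbTE hY) addn0 => pstart.
  by rewrite -ltnS -(outs_del rY) -addn1 pstart hDp.
- rewrite outs_del_id; last by rewrite inE rx' (negbTE xY) andbF.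
  move: pstart; rewrite hY (negbTE xY) addn0 addn1 => ->.
  rewrite ltnNge; apply/negP => tY; case/negP: hX.
  by apply/bigcupP; exists Y => //=; rewrite zY xY.
- rewrite outs_del_id; last by rewrite inE rx' (negbTE xY) andbF.
  by move: pstart; rewrite (negbTE hY) (negbTE xY) !addn0 => ->; apply: hDp.
Qed.

Lemma linkage D p : hall D p ->
  exists w : I -> seq R,
    [/\ forall i, walk (p i) (w i) z,
        forall i r, r \in w i -> r \in D
      & forall i j r, r \in w i -> r \in w j -> i = j].
Proof.
have [m] := ubnP #|D|; elim: m D p => // m IHm D p leDm hDp.
have [/existsP[i piz]|] := boolP [exists i, p i != z]; last first.
  rewrite negb_exists => /forallP allz; exists (fun=> [::]); split=> //= i.
  by have := allz i; rewrite negbK.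
have [r /andP[rD /eqP rx] /IHm[|w [ww wD wdis]]] := hall_step hDp piz.
  by move: leDm; rewrite (cardsD1 r) rD.
exists (fun j => if j == i then r :: w j else w j); split=> [j|j u|j l u].
- by have := ww j; case: eqP => //= ->; rewrite rx eqxx.
- have wj : u \in w j -> u \in D by move/wD; rewrite !inE => /andP[].
  by case: eqP => // _; rewrite inE => /orP[/eqP->|].
have nrw j' : r \notin w j' by apply/negP => /wD; rewrite !inE eqxx.
case: eqP => [->|_]; case: eqP => [->|_] //; last exact: wdis.
  rewrite inE => /orP[/eqP-> rl|]; last exact: wdis.
  by have := nrw l; rewrite rl.
move=> uj; rewrite inE => /orP[/eqP ur|]; last exact: wdis.
by have := nrw j; rewrite -ur uj.
Qed.

(** The arcs will be orientations of edges, so arc-disjoint walks are edge-disjoint only if no edge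
    serves in both directions. In a minimal [D'] every arc leaves a tight set, and the tight sets
    left by two opposite arcs would contradict strict submodularity. *)
Lemma hall_minimal D p : hall D p ->
  exists D', [/\ D' \subset D, hall D' p &
    forall r1 r2, r1 \in D' -> r2 \in D' ->
      tl r1 = hd r2 -> hd r1 = tl r2 -> False].
Proof.
move=> hDp.
pose P := [pred E : {set R} | [forall X : {set V}, (z \notin X) ==>
             (#|[set i | p i \in X]| <= #|outs E X|)]].
have hallP E : reflect (hall E p) (P E).
  by apply: (iffP forallP) => h X; apply/implyP; apply: h.
have [D' /minsetP[/hallP hD' minD'] sD'] := minset_exists (introT (hallP D) hDp).
exists D'; split=> // r1 r2 r1D r2D e1 e2.
have tightP r : r \in D' -> exists X, [/\ z \notin X, r \in outs D' X
    & #|outs D' X| <= #|[set i | p i \in X]|].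
  move=> rD.
  have [/existsP[X /and3P[zX rX tX]]|] := boolP [exists X : {set V},
      [&& z \notin X, r \in outs D' X &
          #|outs D' X| <= #|[set i | p i \in X]|]].
    by exists X.
  rewrite negb_exists => /forallP nX.
  have /minD' /(_ (subD1set _ _)) eqD : P (D' :\ r).
    apply/hallP => X zX; have := nX X; rewrite zX /= negb_and -ltnNge.
    have [rX|rX] := boolP (r \in outs D' X); last by rewrite outs_del_id ?hD'.
    by rewrite (outs_del rX).
  by move: rD; rewrite -eqD !inE eqxx.
have [X [zX + tX]] := tightP _ r1D; have [Y [zY + tY]] := tightP _ r2D.
rewrite !inE r1D r2D -e1 -e2 /= => /andP[h1Y t1Y] /andP[t1X h1X].
have zI : z \notin X :&: Y by rewrite inE (negbTE zX).
have zU : z \notin X :|: Y by rewrite inE negb_or zX.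
have cross : #|outs D' (X :&: Y)| + #|outs D' (X :|: Y)|
    < #|outs D' X| + #|outs D' Y|.
  by apply: (outs_submod_cross r1D); rewrite !inE ?t1X ?t1Y ?h1X ?h1Y.
have := leq_ltn_trans (leq_add (hD' _ zI) (hD' _ zU)) cross.
by rewrite card_starts_mod ltnNge leq_add.
Qed.

End Linkage.

(** * Important cuts *)

Section ImportantCuts.
Variable z : V.

(** The cut form of reachability: every vertex of [X] can be reached from [X :&: S] by arcs of [D]
    inside [X]. *)
Definition spans D S X := forall Z, S \subset Z -> ~~ (X \subset Z) ->
  exists2 r, r \in D &
    [&& tl r \in X, tl r \in Z, hd r \in X & hd r \notin Z].

Lemma spans_sup D S S' X : S \subset S' -> spans D S X ->
  spans D S' (X :|: S').
Proof.
move=> sSS' spX Z sZ nXZ.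
have [||r rD /and4P[tX tZ hX hZ]] := spX Z; first exact: subset_trans sZ.
  by apply: contraNN nXZ => sXZ; rewrite subUset sXZ.
by exists r; rewrite // !inE tX tZ hX hZ.
Qed.

Local Open Scope ring_scope.
Import Order.TTheory GRing.Theory Num.Theory.

(* The bounded-search-tree proof that there are at most [4 ^ c] important cuts
   of size [c].  The number [q.2] is the size charged to the set [q.1] along
   its branch, which may exceed the actual size of its cut. *)
Lemma important_cuts D S l :
    (forall X, z \notin X -> S \subset X -> (l <= #|outs D X|)%N) ->
  exists F : seq ({set V} * nat),
    [/\ forall q, q \in F -> z \notin q.1 /\ (#|outs D q.1| <= q.2)%N,
        forall X, z \notin X -> S \subset X -> spans D S X ->
          exists2 q, q \in F & X \subset q.1 /\ (q.2 <= #|outs D X|)%N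
      & \sum_(q <- F) 4%:R ^- q.2 <= 2%:R ^- l :> rat].
Proof.
have [m] := ubnP (#|D| + #|~: S|)%N.
elim: m D S l => // m IHm D S l ltm minl.
have [zS|zS] := boolP (z \in S).
  exists [::]; split=> // [X zX sSX|]; first by rewrite (subsetP sSX) in zX.
  by rewrite big_nil invr_ge0 exprn_ge0.
pose ok := [pred X : {set V} | (z \notin X) && (S \subset X)].
have okS : ok S by rewrite /= zS subxx.
case: (@arg_minnP _ S ok (fun X => #|outs D X|) okS) => X0 okX0 minX0.
pose l0 := #|outs D X0|; rewrite -/l0 in minX0.
have ll0 : (l <= l0)%N by case/andP: okX0 => zX0 sX0; apply: minl.
pose okm := [pred X : {set V} | ok X && (#|outs D X| <= l0)%N].
have okmX0 : okm X0 by apply/andP.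
(* [M] is a largest minimum cut around [S]: uniting an admissible set with [M] does not increase its
   cut, and proper supersets of [M] avoiding [z] cost more than [l0]. *)
case: (@arg_maxnP _ X0 okm (fun X => #|X|) okmX0) => M okmM maxM.
have /andP[okM leM] := okmM; have /andP[zM sSM] := okM.
have leX X : z \notin X -> S \subset X ->
    (#|outs D (X :|: M)| <= #|outs D X|)%N.
  move=> zX sX; have leI : (l0 <= #|outs D (X :&: M)|)%N.
    by apply: minX0; rewrite /= inE (negbTE zX) subsetI sX.
  rewrite -(leq_add2l l0); apply: leq_trans (leq_add leI (leqnn _)) _.
  by apply: leq_trans (outs_submod D X M) _; rewrite addnC leq_add2r.
have ltX X : z \notin X -> M \proper X -> (l0 < #|outs D X|)%N.
  move=> zX pX; rewrite ltnNge; apply: contraL (proper_card pX) => leXl.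
  rewrite -leqNgt; apply: maxM.
  by rewrite /= zX leXl (subset_trans sSM (proper_sub pX)).
have l2 : 2%:R ^- l0 <= 2%:R ^- l :> rat.
  by rewrite lef_pV2 ?posrE ?exprn_gt0 // ler_eXn2l.
have [l00|l0gt] := posnP l0.
  exists [:: (M, 0%N)]; split=> [q|X zX sX spX|]; last 1 first.
  - by apply: le_trans l2; rewrite big_seq1 l00.
  - by rewrite inE => /eqP->; rewrite -l00.
  exists (M, 0%N); first by rewrite inE.
  split=> //; apply/negPn/negP => nXM.
  have [r rD /and4P[_ tM _ hM]] := spX _ sSM nXM.
  have : r \in outs D M by rewrite inE rD tM.
  by have := leM; rewrite l00 leqn0 cards_eq0 => /eqP->; rewrite inE.
(* Branch on an arc leaving [M]: either its head is absorbed, which raises the minimum cut, or the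
   arc is cut, hence deleted and charged 1. *)
have [r rM] : exists r, r \in outs D M.
  by apply/set0Pn; rewrite -card_gt0 (leq_trans l0gt) ?minX0.
have := rM; rewrite inE => /and3P[rD tM hM].
have pM : M \proper hd r |: M.
  apply/properP; split; first exact: subsetUr.
  by exists (hd r); rewrite ?setU11.
have cM : (#|~: (hd r |: M)| < #|~: S|)%N.
  apply: proper_card; rewrite properC.
  exact: sub_proper_trans pM.
have [||F1 [F1ok F1dom F1sum]] := IHm D (hd r |: M) l0.+1.
- by rewrite -ltnS (leq_trans _ ltm) // ltnS ltn_add2l.
- by move=> X zX sX; apply: ltX => //; apply: proper_sub_trans sX.
have [||F2 [F2ok F2dom F2sum]] := IHm (D :\ r) M l0.-1.
- rewrite -ltnS (leq_trans _ ltm) // ltnS (cardsD1 r D) rD add1n addSn ltnS.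
  by rewrite leq_add2l subset_leq_card // setCS.
- move=> X zX sX; have := minX0 X; rewrite /= zX (subset_trans sSM sX).
  move=> /(_ isT); have [rX|rX] := boolP (r \in outs D X).
    by rewrite (outs_del rX) -subn1 leq_subLR add1n.
  by rewrite (outs_del_id rX); apply: leq_trans; apply: leq_pred.
exists (F1 ++ [seq (q.1, q.2.+1) | q <- F2]); split.
- move=> q; rewrite mem_cat => /orP[/F1ok //|/mapP[q' /F2ok[zq' le'] ->]] /=.
  split=> //; have [rX|rX] := boolP (r \in outs D q'.1).
    by rewrite (outs_del rX).
  by rewrite -(outs_del_id rX) leqW.
- move=> X zX sX spX; have leXM := leX X zX sX.
  have zXM : z \notin X :|: M by rewrite inE negb_or zX.
  have [hX|hX] := boolP (hd r \in X).
    have eXM : X :|: (hd r |: M) = X :|: M.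
      by apply/setP => v; rewrite !inE; case: eqVneq => // ->; rewrite hX.
    have [|||q qF [sq leq_]] := F1dom (X :|: M) => //.
    + by rewrite -eXM subsetUr.
    + rewrite -eXM; apply: spans_sup spX.
      exact: subset_trans sSM (proper_sub pM).
    exists q; first by rewrite mem_cat qF.
    by split; [apply: subset_trans sq; exact: subsetUl | exact: leq_trans leXM].
  have hXM : hd r \notin X :|: M by rewrite inE negb_or hX.
  have rXM : r \in outs D (X :|: M) by rewrite inE rD hXM inE tM orbT.
  have [|||q qF [sq leq_]] := F2dom (X :|: M) => //; first exact: subsetUr.
    move=> Z sMZ /(spans_sup sSM spX sMZ)[u uD /and4P[tu tZ hu hZ]].
    exists u; last by rewrite tu tZ hu.
    by rewrite !inE uD andbT; apply: contraNneq hXM => <-.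
  exists (q.1, q.2.+1).
    by rewrite mem_cat; apply/orP; right; apply/mapP; exists q.
  split=> /=; first by apply: subset_trans sq; exact: subsetUl.
  by apply: leq_trans leXM; rewrite (outs_del rXM).
(* The weights balance: [2 ^- l0.+1 + 2 ^- l0.-1 / 4 = 2 ^- l0]. *)
apply: le_trans l2; rewrite big_cat big_map /=.
have -> : \sum_(q <- F2) 4%:R ^- q.2.+1
    = 4%:R^-1 * \sum_(q <- F2) 4%:R ^- q.2 :> rat.
  by rewrite mulr_sumr; apply: eq_bigr => q _; rewrite exprS invfM.
move: F1sum F2sum; rewrite -{3}(prednK l0gt) -[in X in X -> _](prednK l0gt).
rewrite !exprS !invfM.
move: (\sum_(q <- F1) _) (\sum_(q <- F2) _) (2%:R ^- _) => s1 s2 t.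
lra.
Qed.

End ImportantCuts.

End Digraph.

(** * Random colourings *)

Section SparseSubset.
Variable T : finType.
Implicit Types (U Y : {set T}) (a : T).

Lemma card_bigcup_leq (I : finType) (P : pred I) (S : finType)
    (E : I -> {set S}) :
  #|\bigcup_(i | P i) E i| <= \sum_(i | P i) #|E i|.
Proof.
elim/big_rec2: _ => [|i X m _ leX]; first by rewrite cards0.
by rewrite (leq_trans (leq_card_setU _ _)) ?leq_add2l.
Qed.

(** Such a colouring is given by one common colour and its values off [a |: U], that is, by
    [#|T| - #|U|] free choices. *)
Lemma card_monochromatic N a U : a \notin U ->
  #|[set f : {ffun T -> 'I_N} | [forall y in U, f y == f a]]| * N ^ #|U|
    <= N ^ #|T|.
Proof.
move=> aU; set S := finset _.
have leS : #|S| <= N * N ^ #|~: (a |: U)|.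
  have sS : S \subset \bigcup_(i : 'I_N)
      [set f in pffun_on i (mem (~: (a |: U))) predT].
    apply/subsetP => f; rewrite inE => /forall_inP fU.
    apply/bigcupP; exists (f a) => //; rewrite inE.
    apply/pffun_onP; split=> //; apply/subsetP => y; rewrite !inE.
    by apply: contraNN => /orP[/eqP->|/fU].
  apply: leq_trans (subset_leq_card sS) _.
  apply: leq_trans (card_bigcup_leq _ _) _.
  have -> (m : nat) : N * m = \sum_(i < N) m by rewrite sum_nat_const card_ord.
  by apply: leq_sum => i _; rewrite cardsE card_pffun_on card_ord.
apply: leq_trans (leq_mul leS (leqnn _)) _.
rewrite -expnS -expnD; have := cardsC (a |: U); rewrite cardsU1 aU /= => <-.
by rewrite add1n addSnnS addnC.
Qed.

(** The charged cut [q] is too small to carry [k] units from each member of [X] on its near side. A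
    single member is left to the cut condition of the k-system; with two or more, dropping one keeps
    at least half. *)
Definition crowded k (X : {set T}) (q : {set T} * nat) :=
  (1 < #|X :&: q.1|) && (q.2 < k * #|X :&: q.1|).

Lemma crowded_sub k (X X' : {set T}) q :
  X \subset X' -> crowded k X q -> crowded k X' q.
Proof.
move=> sXX' /andP[h1 h2].
have le : #|X :&: q.1| <= #|X' :&: q.1| by apply/subset_leq_card/setSI.
by rewrite /crowded (leq_trans h1) // (leq_trans h2) // leq_mul2l le orbT.
Qed.

Definition color_class N (f : {ffun T -> 'I_N}) a := [set y | f y == f a].

(* A crowded colour class contains, besides [a], a set [U] of more than
   [q.2 / (2 * k)] points of [q.1], and [256 ^ k] equals [16 ^ (2 * k)]. *)
Lemma card_crowded_class k a (q : {set T} * nat) : #|q.1| <= q.2 ->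
  2 * (#|[set f : {ffun T -> 'I_(256 ^ k)} | crowded k (color_class f a) q]|
    * 4 ^ q.2) <= (256 ^ k) ^ #|T|.
Proof.
set N := 256 ^ k; case: q => Y c /= leY; set S := finset _.
pose P := [pred U : {set T} | (U \in powerset (Y :\ a)) && (c < 2 * k * #|U|)].
pose mono U := [set f : {ffun T -> 'I_N} | [forall y in U, f y == f a]].
have sS : S \subset \bigcup_(U | P U) mono U.
  apply/subsetP => f; rewrite inE => /andP[/= h1 h2].
  apply/bigcupP; exists ((color_class f a :&: Y) :\ a); last first.
    by rewrite inE; apply/forall_inP => y; rewrite !inE => /and3P[].
  rewrite /P /= powersetE setSD ?subsetIr //=.
  have := cardsD1 a (color_class f a :&: Y).
  by case: (a \in _) => /=; nia.
have leS : #|S| <= \sum_(U | P U) #|mono U|.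
  by apply: leq_trans (subset_leq_card sS) (card_bigcup_leq _ _).
have leU U : P U -> #|mono U| * 16 ^ c.+1 <= N ^ #|T|.
  case/andP; rewrite powersetE subsetD1 => /andP[_ aU] ltc.
  apply: leq_trans (card_monochromatic N aU); rewrite leq_mul2l.
  by apply/orP; right; rewrite /N -(expnM 16 2 k) -expnM leq_exp2l.
(* Union bound over at most [2 ^ c] sets [U]. Of [16 ^ c], one factor [2 ^ c] pays for this, [4 ^ c]
   is the weight, and the other [2 ^ c] is slack. *)
have : #|S| * 16 ^ c.+1 <= 2 ^ c * N ^ #|T|.
  apply: leq_trans (leq_mul leS (leqnn _)) _; rewrite big_distrl /=.
  apply: (@leq_trans (\sum_(U | P U) N ^ #|T|)); first exact: leq_sum.
  rewrite sum_nat_const leq_mul2r.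
  apply/orP; right; apply: leq_trans (_ : #|powerset (Y :\ a)| <= _).
    by apply/subset_leq_card/subsetP => U /andP[].
  rewrite card_powerset leq_exp2l //; apply: leq_trans leY.
  exact/subset_leq_card/subsetDl.
rewrite expnS (_ : 16 ^ c = 2 ^ c * (2 ^ c * 4 ^ c)); last first.
  by rewrite -!expnMn.
have : 0 < 2 ^ c by rewrite expn_gt0.
move: (2 ^ c) (4 ^ c) (N ^ #|T|) => u v w u0 h.
have {}h : 16 * (#|S| * v * u) <= w.
  by rewrite -(leq_pmul2l u0); apply: leq_trans h; nia.
apply: leq_trans h; apply: leq_mul => //.
exact: leq_pmulr.
Qed.

Import Order.TTheory GRing.Theory Num.Theory.

(** Union bound: each [q] is crowded with probability at most [4 ^- q.2 / 2]. *)
Lemma card_crowded k a (F : seq ({set T} * nat)) :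
    (forall q, q \in F -> #|q.1| <= q.2) ->
    (\sum_(q <- F) 4%:R ^- q.2 <= 1 :> rat)%R ->
  2 * #|[set f : {ffun T -> 'I_(256 ^ k)} |
           has (crowded k (color_class f a)) F]| <= (256 ^ k) ^ #|T|.
Proof.
move=> Fle Fsum; set N := 256 ^ k.
rewrite -(ler_nat rat) natrM.
apply: le_trans (_ : ((N ^ #|T|)%:R * \sum_(q <- F) 4%:R ^- q.2 <= _)%R); last first.
  by apply: ler_piMr.
have {Fsum} := Fle; elim: F {Fle} => [|q F IHF] Fle.
  rewrite big_nil (_ : finset _ = set0); first by rewrite cards0 !mulr0.
  by apply/setP => f; rewrite !inE.
rewrite big_cons mulrDr.
set S := finset _.
pose S1 := [set f : {ffun T -> 'I_N} | crowded k (color_class f a) q].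
pose S2 := [set f : {ffun T -> 'I_N} | has (crowded k (color_class f a)) F].
have -> : S = S1 :|: S2 by apply/setP => f; rewrite !inE.
have le1 : (2%:R * #|S1|%:R <= (N ^ #|T|)%:R * 4%:R ^- q.2 :> rat)%R.
  rewrite ler_pdivlMr ?exprn_gt0 // -natrX -!natrM ler_nat -mulnA.
  by apply: card_crowded_class; apply: Fle; rewrite inE eqxx.
have le2 := IHF (fun q' h => Fle q' (@mem_behead _ (q :: F) q' h)).
apply: le_trans (lerD le1 le2); rewrite -mulrDr ler_pM2l // -natrD ler_nat.
by rewrite -cardsUI leq_addr.
Qed.

(** By double counting, some colouring makes at most half of [B] bad. At least [256 ^ k * n] good
    elements remain, so some colour occurs on [n] of them; shrinking a colour class creates no
    crowding. *)
Lemma sparse_subset k n (B : {set T}) (F : T -> seq ({set T} * nat)) :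
    (forall a q, a \in B -> q \in F a -> #|q.1| <= q.2) ->
    (forall a, a \in B -> \sum_(q <- F a) 4%:R ^- q.2 <= 1 :> rat)%R ->
    2 * (256 ^ k * n) <= #|B| ->
  exists A : {set T}, [/\ A \subset B, n <= #|A| &
    forall a q, a \in A -> q \in F a -> ~~ crowded k A q].
Proof.
move=> Fle Fsum leB; set N := 256 ^ k in leB.
have N0 : 0 < N by rewrite expn_gt0.
pose is_bad (f : {ffun T -> 'I_N}) a := has (crowded k (color_class f a)) (F a).
pose bad f := [set a in B | is_bad f a].
have [/existsP[f lef]|] := boolP [exists f, 2 * #|bad f| <= #|B|]; last first.
  rewrite negb_exists => /forallP nbad.
  have : \sum_(f : {ffun T -> 'I_N}) 2 * #|bad f| <= #|B| * N ^ #|T|.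
    have -> : \sum_(f : {ffun T -> 'I_N}) 2 * #|bad f| =
        \sum_(a in B) 2 * #|[set f | is_bad f a]|.
      rewrite -!big_distrr /=; congr (2 * _).
      transitivity (\sum_f \sum_(a in B) (is_bad f a : nat)).
        apply: eq_bigr => f _; rewrite -sum1_card big_mkcond [RHS]big_mkcond.
        apply: eq_bigr => a _; rewrite !inE; case: (a \in B) => //=.
      rewrite exchange_big; apply: eq_bigr => a _.
      rewrite -sum1_card [RHS]big_mkcond; apply: eq_bigr => f _.
      by rewrite inE; case: (is_bad f a).
    rewrite -sum_nat_const; apply: leq_sum => a aB.
    by apply: card_crowded; [move=> q; apply: Fle | apply: Fsum].
  have : \sum_(f : {ffun T -> 'I_N}) #|B|.+1 <= \sum_f 2 * #|bad f|.
    by apply: leq_sum => f _; rewrite ltnNge nbad.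
  rewrite sum_nat_const card_ffun card_ord => h1 h2.
  have := leq_trans h1 h2; rewrite mulnC leq_pmul2r ?ltnn // expn_gt0 N0 //.
pose good := B :\: bad f.
have leg : N * n <= #|good|.
  have : #|good| + #|bad f| = #|B|.
    rewrite addnC -(cardsID (bad f) B) (_ : B :&: bad f = bad f) //.
    by apply/setIidPr/subsetP => a; rewrite inE => /andP[].
  lia.
have [/existsP[i lei]|] :=
    boolP [exists i : 'I_N, n <= #|[set a in good | f a == i]|].
  exists [set a in good | f a == i]; split=> // [|a q].
    by apply/subsetP => a; rewrite !inE => /andP[/andP[]].
  rewrite !inE => /andP[/andP[+ aB] /eqP fa] qF; rewrite aB /= => /hasPn/(_ q qF).
  apply: contraNN; apply: crowded_sub; apply/subsetP => y.
  by rewrite !inE fa => /andP[].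
rewrite negb_exists => /forallP nbig.
have : #|good| < N * n; last by rewrite ltnNge leg.
have -> : #|good| = \sum_(i : 'I_N) #|[set a in good | f a == i]|.
  rewrite -sum1_card (partition_big f predT) //=; apply: eq_bigr => i _.
  by rewrite -sum1_card; apply: eq_bigl => a; rewrite !inE.
have n0 : 0 < n.
  by have := nbig (Ordinal N0); rewrite -ltnNge; case: (n).
apply: leq_ltn_trans (_ : N * n.-1 < _); last by rewrite ltn_pmul2l // prednK.
have -> (m : nat) : N * m = \sum_(i < N) m by rewrite sum_nat_const card_ord.
apply: leq_sum => i _.
by rewrite -ltnS prednK // ltnNge nbig.
Qed.

End SparseSubset.

(** * The auxiliary network *)

Section Arcs.
Variable G : mgraph.

Definition src (x : edge G * bool) : G := if x.2 then end1 x.1 else end2 x.1.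
Definition dst (x : edge G * bool) : G := if x.2 then end2 x.1 else end1 x.1.
Definition rev_arc (x : edge G * bool) := (x.1, ~~ x.2).

Lemma src_rev x : src (rev_arc x) = dst x.
Proof. by case: x => e []. Qed.

Lemma dst_rev x : dst (rev_arc x) = src x.
Proof. by case: x => e []. Qed.

(** Walks along these arcs never enter [A], which will make the immersion strong. *)
Definition arcs_avoiding (A : {set G}) := [set x | dst x \notin A].

Lemma edge_cut_outs (X : {set G}) : #|edge_cut X| <= #|outs src dst setT X|.
Proof.
rewrite -(card_imset (f := fun e => (e, end1 e \in X))); last by move=> e f [].
apply/subset_leq_card/subsetP => _ /imsetP[e + ->]; rewrite !inE /src /dst /=.
by case e1X: (end1 e \in X) => /=; rewrite ?e1X /=; case: (end2 e \in X).
Qed.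

End Arcs.
Arguments src {G} x.
Arguments dst {G} x.

Section Spokes.
Variables (G : mgraph) (k : nat) (s : G) (T : {set G}).

Lemma connect_cross (V : finType) (e : rel V) (P : pred V) x y :
  connect e x y -> P x -> ~~ P y -> exists u v, [/\ e u v, P u & ~~ P v].
Proof.
case/connectP=> p; elim: p x => [|w p IHp] x /=; first by move=> _ -> ->.
case/andP=> exw pw yl Px nPy.
by have [Pw|nPw] := boolP (P w); [exact: (IHp w) | exists x, w].
Qed.

Lemma sconnected_cross (C : subgraph G) (P : pred G) x y :
    sconnected C -> x \in sverts C -> y \in sverts C -> P x -> ~~ P y ->
  exists u, [/\ u.1 \in sedges C, P (src u) & ~~ P (dst u)].
Proof.
move=> [_ cC] xC yC Px nPy.
have [v [w [/existsP[e /andP[eC vw] Pv nPw]]]] := connect_cross (cC x y xC yC) Px nPy.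
case/orP: vw => /andP[/eqP ev /eqP ew]; [exists (e, true)|exists (e, false)];
by rewrite /src /dst /= -ev -ew.
Qed.

(** The spoke [C t] will be the image of one edge of [H] at the ray mapped to [t]. *)
Variable C : G -> subgraph G.
Hypothesis k_gt0 : 0 < k.
Hypothesis C_conn : forall t, t \in T -> sconnected (C t).
Hypothesis C_s : forall t, t \in T -> s \in sverts (C t).
Hypothesis C_t : forall t, t \in T -> t \in sverts (C t).
Hypothesis C_strong :
  forall t u, t \in T -> u \in T -> u != t -> u \notin sverts (C t).
Hypothesis C_disj : forall t u, t \in T -> u \in T -> t != u ->
  [disjoint sedges (C t) & sedges (C u)].
Hypothesis k_conn : forall t (X : {set G}), t \in T -> t \in X -> s \notin X ->
  k <= #|edge_cut X|.

(* The network in which a ray [t] is split into an entry [(t, false)] and an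
   exit [(t, true)] joined by [k] arcs, so that a cut may also pay [k] to stop
   at [t].  A vertex [v] outside [T] is represented by [(v, true)] only, and
   its [k] arcs are loops. *)
Let W : finType := (G * bool)%type.
Let R : finType := ((edge G * bool) + (G * 'I_k))%type.
Let inn (v : G) : W := (v, v \notin T).
Let tlW (r : R) : W :=
  match r with inl x => (src x, true) | inr p => inn p.1 end.
Let hdW (r : R) : W :=
  match r with inl x => inn (dst x) | inr p => (p.1, true) end.

Definition touched (Y : {set G * bool}) :=
  [set t in T | ((t, true) \in Y) || ((t, false) \in Y)].

(** Each touched [t] owns an arc leaving [Y]: one along [C t], which leads to [s], if the exit of
    [t] is in [Y], and otherwise a splitting arc of [t]. Spokes being edge-disjoint, different [t]
    own different arcs. *)
Lemma touched_le (Y : {set W}) : (s, true) \notin Y ->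
  #|touched Y| <= #|outs tlW hdW setT Y|.
Proof.
move=> sY.
pose owns t (r : R) := match r with
  inl x => x.1 \in sedges (C t) | inr p => p.1 == t end.
have owns_inj t u r : t \in T -> u \in T -> owns t r -> owns u r -> t = u.
  case: r => [x|p] /= tT uT; last by move=> /eqP<- /eqP.
  move=> tx ux; apply/eqP/negPn/negP => ntu.
  by have := C_disj tT uT ntu; rewrite disjoint_subset => /subsetP/(_ _ tx);
    rewrite !inE ux.
have ownsP t : t \in touched Y -> exists2 r, r \in outs tlW hdW setT Y & owns t r.
  rewrite inE => /andP[tT]; have [tY _|tY /= fY] := boolP ((t, true) \in Y).
    have := @sconnected_cross (C t) (fun v => (v, true) \in Y) t s
      (C_conn tT) (C_t tT) (C_s tT) tY sY.
    case=> u [uC uY nuY]; exists (inl u) => //; rewrite !inE /= uY /= /inn.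
    have [dT|//] := boolP (dst u \in T).
    have dC : dst u \in sverts (C t).
      have /forall_inP/(_ _ uC)/andP[] := sends (C t).
      by rewrite /dst; case: (u.2).
    have dt : dst u = t by apply: contraTeq dC; exact: C_strong.
    by rewrite dt tY in nuY.
  exists (inr (t, Ordinal k_gt0)); last by rewrite /= eqxx.
  by rewrite !inE /= /inn tT fY.
pose g r := [pick t in T | owns t r].
rewrite -(card_imset _ Some_inj).
apply: leq_trans (leq_imset_card g _).
apply/subset_leq_card/subsetP => _ /imsetP[t tY ->].
have [r rY tr] := ownsP t tY; apply/imsetP; exists r => //; rewrite /g.
have tT : t \in T by move: tY; rewrite inE => /andP[].
case: pickP => [u /andP[uT ur]|/(_ t)]; last by rewrite tT tr.
by rewrite (owns_inj _ _ _ tT uT tr ur).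
Qed.

(* One charges [k] to every member of [A] adjacent to a connected set [X]
   violating Hall's condition.  Except when [X] touches a single member of [A],
   the important cut beyond [X] is then crowded. *)
Lemma exists_hall_subset n : 2 * (256 ^ k * n) <= #|T| ->
  exists A : {set G}, [/\ A \subset T, n <= #|A| &
    forall X : {set G}, s \notin X ->
      k * #|A :&: X| <= #|outs src dst (arcs_avoiding A) X|].
Proof.
move=> leT.
have [F FP] := fin_all_exists (fun a : G =>
  @important_cuts W R tlW hdW (s, true) setT [set (a, true); (a, false)] 0
    (fun X _ _ => leq0n _)).
pose F' a := [seq (touched q.1, q.2) | q <- F a].
have [||A [sAT leA nA]] := @sparse_subset G k n T F' _ _ leT.
- move=> a _ aT /mapP[q qF ->] /=; have [+ _ _] := FP a.
  by move=> /(_ q qF)[sq]; apply: leq_trans; apply: touched_le.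
- by move=> a aT; rewrite big_map /=; have [_ _] := FP a;
    rewrite GRing.expr0 GRing.invr1.
exists A; split=> // X; have [m] := ubnP #|X|; elim: m X => // m IHm X ltm sX.
set D := arcs_avoiding A.
(* If no edge joins [X :&: Z] to [X :\: Z], every arc leaving one part leaves [X], so the bounds for
   the two parts add up. *)
have [/existsP[Z /and3P[XZ XnZ /forallP noarc]]|] := boolP [exists Z : {set G},
    [&& X :&: Z != set0, X :\: Z != set0 &
        [forall x, ~~ [&& src x \in X, src x \in Z,
                          dst x \in X & dst x \notin Z]]]].
  have noarc' x :
      [&& src x \in X, src x \notin Z, dst x \in X & dst x \in Z] = false.
    have := noarc (rev_arc x); rewrite src_rev dst_rev => /negbTE <-.
    by do 2![case: (src x \in _)]; do 2![case: (dst x \in _)].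
  have cX := cardsID Z X; rewrite -!card_gt0 in XZ XnZ.
  have ltI : #|X :&: Z| < m by lia.
  have ltD : #|X :\: Z| < m by lia.
  have sI : s \notin X :&: Z by rewrite inE (negbTE sX).
  have sD : s \notin X :\: Z by rewrite inE (negbTE sX) andbF.
  apply: leq_trans (leq_trans (leq_add (IHm _ ltI sI) (IHm _ ltD sD)) _).
    rewrite -mulnDr leq_mul2l -(cardsID Z (A :&: X)) setIA setIDA.
    by rewrite leqnn orbT.
  rewrite -cardsUI [X in _ + X](_ : _ = 0) ?addn0; last first.
    apply/eqP; rewrite cards_eq0; apply/eqP/setP => x; rewrite !inE.
    by do 2![case: (src x \in _)]; rewrite ?andbF.
  apply/subset_leq_card/subsetP => x; have := noarc x; have := noarc' x.
  rewrite !inE; case: (dst x \in A) => //=.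
  by do 2![case: (src x \in _)]; do 2![case: (dst x \in _)].
rewrite negb_exists => /forallP cX.
have {}cX Z : X :&: Z != set0 -> X :\: Z != set0 -> exists x : edge G * bool,
    [&& src x \in X, src x \in Z, dst x \in X & dst x \notin Z].
  move=> XZ XnZ; have := cX Z; rewrite XZ XnZ /= => /forallPn[x].
  by rewrite negbK; exists x.
have [AX0|] := eqVneq (A :&: X) set0; first by rewrite AX0 cards0 muln0.
case/set0Pn=> a; rewrite inE => /andP[aA aX].
have aT := subsetP sAT _ aA.
pose B := [set b in A | (b \notin X) && [exists x, (src x \in X) && (dst x == b)]].
have BP x : src x \in X -> dst x \notin X -> dst x \in A -> dst x \in B.
  by move=> xX nX xA; rewrite !inE xA nX; apply/existsP; exists x; rewrite xX /=.
(* If [a] is the only member of [A] in or next to [X], no arc leaving [X] enters [A], and the whole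
   edge cut is available. *)
have [B0|B0] := eqVneq (#|A :&: X| + #|B|) 1.
  have AX1 : #|A :&: X| = 1.
    apply/eqP; rewrite eqn_leq -{1}B0 leq_addr card_gt0; apply/set0Pn.
    by exists a; rewrite inE aA.
  move/eqP: B0; rewrite AX1 -[X in _ == X]addn0 eqn_add2l cards_eq0 => /eqP B0.
  rewrite muln1; apply: leq_trans (k_conn aT aX sX) _.
  apply: leq_trans (edge_cut_outs X) _.
  apply/subset_leq_card/subsetP => x; rewrite !inE => /and3P[_ xX nX].
  rewrite xX nX !andbT; apply/negP => xA.
  by have := BP x xX nX xA; rewrite B0 inE.
(* Containing the entries but not the exits of [B], the set [Xd] pays [k] splitting arcs for each
   member of [B], while arcs from [X] into [B] stay inside. *)
pose Xd : {set W} :=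
  [set w | if w.2 then w.1 \in X else (w.1 \in X :&: T) || (w.1 \in B)].
have XdE v b : ((v, b) \in Xd) =
    if b then v \in X else (v \in X :&: T) || (v \in B).
  by rewrite inE.
have spX : spans tlW hdW setT [set (a, true); (a, false)] Xd.
  move=> Z; rewrite subUset !sub1set => /andP[aZ aZ'] nXZ.
  have [/existsP[r /andP[rZ rX]]|] := boolP [exists r : R,
      (tlW r \in Xd :&: Z) && (hdW r \in Xd :\: Z)].
    exists r => //; move: rZ rX; rewrite !inE.
    by move=> /andP[-> ->] /andP[-> ->].
  rewrite negb_exists => /forallP noarc; case/negP: nXZ.
  have arcP x : src x \in X -> (src x, true) \in Z -> inn (dst x) \in Xd ->
      inn (dst x) \in Z.
    move=> xX xZ dX; apply/negPn/negP => dZ; case/negP: (noarc (inl x)).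
    by rewrite in_setI in_setD /= xZ dX dZ XdE xX.
  have outP v : v \in X -> v \in T -> (v, false) \in Z -> (v, true) \in Z.
    move=> vX vT vZ; apply/negPn/negP => vZ'.
    case/negP: (noarc (inr (v, Ordinal k_gt0))).
    by rewrite in_setI in_setD /= /inn vT vZ vZ' !XdE inE vX vT.
  have XZ v : v \in X -> (v, true) \in Z.
    move=> vX; apply/negPn/negP => vZ.
    have [||x] := cX [set v | (v, true) \in Z].
    - by apply/set0Pn; exists a; rewrite !inE aX.
    - by apply/set0Pn; exists v; rewrite !inE vX vZ.
    rewrite !inE => /and4P[xX xZ dX dZ]; case/negP: dZ.
    have := arcP x xX xZ; rewrite /inn.
    have [dT|dT] := boolP (dst x \in T); last by apply; rewrite XdE.
    by rewrite XdE inE dX dT => /(_ isT); apply: outP.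
  apply/subsetP => -[v b]; rewrite XdE; case: b; first exact: XZ.
  case/orP=> [|vB].
    (* Connectedness of [X] gives an arc into [v] from another vertex of [X], and this arc reaches
       the entry of [v]. *)
    rewrite inE => /andP[vX vT]; have [->//|nva] := eqVneq v a.
    have [||x] := cX (~: [set v]).
    - by apply/set0Pn; exists a; rewrite !inE aX eq_sym.
    - by apply/set0Pn; exists v; rewrite !inE vX eqxx.
    rewrite !inE negbK => /and4P[xX _ _ /eqP dv].
    have := arcP x xX (XZ _ xX); rewrite dv /inn vT; apply.
    by rewrite XdE inE vX vT.
  have := vB; rewrite !inE => /and3P[vA _ /existsP[x /andP[xX /eqP dv]]].
  have := arcP x xX (XZ _ xX); rewrite dv /inn (subsetP sAT _ vA); apply.
  by rewrite XdE vB orbT.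
have outXd : #|outs tlW hdW setT Xd| <= #|outs src dst D X| + k * #|B|.
  rewrite -(card_imset (f := @inl _ (G * 'I_k)) (outs src dst D X)); last first.
    by move=> x y [].
  have -> : k * #|B| = #|[set (inr p : R) | p in setX B [set: 'I_k]]|.
    by rewrite card_imset ?cardsX ?cardsT ?card_ord 1?mulnC // => x y [].
  apply: leq_trans (leq_card_setU _ _).1.
  apply/subset_leq_card/subsetP => -[x|[v i]]; rewrite in_setU in_set in_setT /=.
    move=> /andP[]; rewrite XdE => xX dX.
    apply/orP; left; apply/imsetP; exists x => //.
    have dnX : dst x \notin X.
      apply: contra dX => dX; rewrite /inn XdE inE dX.
      by case: (dst x \in T).
    rewrite !inE xX dnX !andbT; apply: contra dX => dA.
    by rewrite /inn (subsetP sAT _ dA) XdE BP ?orbT.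
  rewrite /inn !XdE => /andP[+ vX].
  have [vT|_] := boolP (v \in T); last by rewrite (negbTE vX).
  rewrite /= inE (negbTE vX) /= => vB.
  by apply/orP; right; apply/imsetP; exists (v, i); rewrite // inE vB inE.
have [_ /(_ Xd) Fdom _] := FP a.
have [|||q qF [sXq leq_]] := Fdom.
- by rewrite XdE.
- by rewrite subUset !sub1set !XdE inE aX aT.
- exact: spX.
have : (touched q.1, q.2) \in F' a by apply/mapP; exists q.
move=> /(nA a _ aA); rewrite negb_and -!leqNgt /=.
have leAB : #|A :&: X| + #|B| <= #|A :&: touched q.1|.
  have <- : #|(A :&: X) :|: B| = #|A :&: X| + #|B|.
    rewrite -cardsUI [X in _ + X](_ : _ = 0) ?addn0 //.
    apply/eqP; rewrite cards_eq0; apply/eqP/setP => x; rewrite !inE.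
    by case: (x \in X); rewrite ?andbF.
  apply/subset_leq_card/subsetP => x xAB.
  have xA : x \in A by move: xAB; rewrite !inE => /orP[]/andP[].
  rewrite !inE xA (subsetP sAT _ xA) /=.
  case/setUP: xAB => [/setIP[_ xX]|xB]; apply/orP; [left|right];
    by apply: (subsetP sXq); rewrite XdE ?xB ?orbT.
have AX0 : 0 < #|A :&: X| by apply/card_gt0P; exists a; rewrite inE aA.
(* Either the near side holds at most one member of [A], which [B0] excludes, or the cut of [Xd] is
   large enough and [k * #|B|] cancels. *)
case/orP=> [le1|leq2].
  by case/negP: B0; rewrite eqn_leq (leq_trans leAB le1) addn_gt0 AX0.
rewrite -(leq_add2r (k * #|B|)) -mulnDr.
apply: leq_trans outXd; apply: leq_trans leq_; apply: leq_trans leq2.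
by rewrite leq_mul2l leAB orbT.
Qed.

End Spokes.

(** * Assembling the immersion *)

Section WalkSubgraph.
Variable G : mgraph.
Implicit Types (a v z : G) (w : seq (edge G * bool)).

(** The start [a] is listed separately because the walk may be empty. *)
Definition walk_verts a w :=
  [set v | (v == a) || has (fun x => (v == src x) || (v == dst x)) w].

Lemma walk_sends a w : [forall e in [set x.1 | x in w],
  (end1 e \in walk_verts a w) && (end2 e \in walk_verts a w)].
Proof.
apply/forall_inP => _ /imsetP[x xw ->]; rewrite !inE.
by apply/andP; split; apply/orP; right; apply/hasP; exists x => //;
  rewrite /src /dst; case: (x.2); rewrite eqxx ?orbT.
Qed.

Definition walk_subgraph a w := Subgraph (walk_sends a w).

Lemma walk_vertsP a w z v : walk src dst a w z -> v \in walk_verts a w ->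
  v = a \/ exists2 x, x \in w & v = dst x.
Proof.
elim: w a => [|y w IHw] a /=; first by rewrite inE orbF => _ /eqP; left.
case/andP=> /eqP ya wz; rewrite inE /= => /or3P[/eqP|/orP[]/eqP|vw]; first by left.
- by rewrite ya; left.
- by move=> ->; right; exists y; rewrite ?mem_head.
case: (IHw _ wz); first by rewrite inE vw orbT.
  by move=> ->; right; exists y; rewrite ?mem_head.
by case=> x xw ->; right; exists x; rewrite // inE xw orbT.
Qed.

Lemma walk_end a w z : walk src dst a w z -> z \in walk_verts a w.
Proof.
elim: w a => [|y w IHw] a /=; first by move=> /eqP->; rewrite inE eqxx.
case/andP=> _ /IHw; rewrite !inE /= => /orP[->|->]; by rewrite ?orbT.
Qed.

Lemma sadj_sym (D : subgraph G) : symmetric (sadj D).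
Proof.
by move=> x y; apply: eq_existsb => e; rewrite orbC [X in X || _]andbC
  [X in _ || X]andbC.
Qed.

Lemma walk_sconnected a w z : walk src dst a w z ->
  sconnected (walk_subgraph a w).
Proof.
move=> wz; split; first by apply/set0Pn; exists a; rewrite inE eqxx.
have adj x : x \in w -> sadj (walk_subgraph a w) (src x) (dst x).
  move=> xw; apply/existsP; exists x.1; rewrite imset_f //=.
  by rewrite /src /dst; case: (x.2); rewrite !eqxx ?orbT.
have walkc (e : rel G) b w' : (forall x, x \in w' -> e (src x) (dst x)) ->
    walk src dst b w' z -> forall x, x \in w' -> connect e b (dst x).
  elim: w' b => // y w' IHw b ew /= /andP[/eqP<- wz'].
  have ey : connect e (src y) (dst y).
    by apply: connect1; apply: ew; rewrite mem_head.
  move=> x; rewrite inE => /orP[/eqP->//|xw].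
  apply: connect_trans ey (IHw _ _ wz' x xw) => u uw; apply: ew.
  by rewrite inE uw orbT.
have ac v : v \in walk_verts a w -> connect (sadj (walk_subgraph a w)) a v.
  case/(walk_vertsP wz) => [->|[x xw ->]]; first exact: connect0.
  exact: (walkc _ a w adj wz).
move=> x y xw yw; apply: connect_trans (ac y yw).
by rewrite (sym_connect_sym (@sadj_sym _)) ac.
Qed.

End WalkSubgraph.

(** Send [k] units from each of [n] members of [A] to [s]. A minimal arc set makes the walks
    edge-disjoint, and since no arc enters [A], each walk meets [A] only at its start. *)
Lemma star_immersion_of_hall (G : mgraph) (k n : nat) (s : G) (A : {set G}) :
    s \notin A -> n <= #|A| ->
    (forall X : {set G}, s \notin X ->
      k * #|A :&: X| <= #|outs src dst (arcs_avoiding A) X|) ->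
  exists theta : im_map (star n k) G,
    [/\ is_strong_immersion theta, theta (star_center n k) = s
      & im_vert theta @: rays (star_center n k) \subset A].
Proof.
move=> sA leA hA.
pose r (i : 'I_n) : G := enum_val (widen_ord leA i).
have rA i : r i \in A by apply: enum_valP.
have r_inj : injective r.
  by move=> i j /enum_val_inj/(congr1 val)/= ij; apply: val_inj.
pose p (e : 'I_n * 'I_k) := r e.1.
have hp : hall src dst s (arcs_avoiding A) p.
  move=> X sX; apply: leq_trans (hA X sX).
  have -> : [set e | p e \in X] = setX [set i | r i \in X] [set: 'I_k].
    by apply/setP => -[i j]; rewrite !inE andbT.
  rewrite cardsX cardsT card_ord mulnC leq_mul2l -(card_imset _ r_inj).
  apply/orP; right; apply/subset_leq_card/subsetP => _ /imsetP[i + ->].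
  by rewrite !inE rA.
have [D [sD hD opp]] := hall_minimal hp.
have [w [ww wD wdis]] := linkage hD.
pose theta := @ImMap (star n k) G
  (fun v => if v is Some i then r i else s)
  (fun e => walk_subgraph (p e) (w e)).
have rs i : r i != s by apply: contraNneq sA => <-.
exists theta; split=> //; last first.
  by apply/subsetP => _ /imsetP[[i|] + ->]; rewrite ?inE // => _; apply: rA.
split; first split.
- case=> [i|] [j|] //= => [/r_inj->//|/eqP|/eqP].
    by rewrite (negbTE (rs i)).
  by rewrite eq_sym (negbTE (rs j)).
- by move=> e; apply: walk_sconnected (ww e).
- move=> e f nef; rewrite disjoint_subset; apply/subsetP => _ /imsetP[x xe ->].
  rewrite inE; apply/imsetP => -[y yf exy].
  have [e12|ne12] := eqVneq x.2 y.2.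
    have exy' : x = y by move: e12 exy; case: (x) (y) => ? ? [? ?] /= -> ->.
    by case/eqP: nef; apply: (wdis e f x); rewrite // exy'.
  have yx : y = rev_arc x.
    move: exy ne12; case: (x) (y) => a b [c d] /= ->; rewrite /rev_arc /=.
    by case: b d => [] [].
  by case: (opp x y (wD _ _ xe) (wD _ _ yf)); rewrite yx ?src_rev ?dst_rev.
- move=> [i j] v /orP[]/eqP-> /=; first exact: walk_end (ww _).
  by rewrite inE eqxx.
- by [].
move=> [i j] [v|] /=; rewrite /incident /= ?eqxx // => nvi.
apply/negP => /(walk_vertsP (ww (i, j)))[/r_inj vi|[x xw rx]].
  by rewrite vi eqxx in nvi.
have /(subsetP sD) := wD _ _ xw.
by rewrite inE -rx rA.
Qed.

(** Every edge has a ray among its ends, so many edges force many rays. *)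
Lemma multistar_card_edges (H : mgraph) (c : H) (k : nat) :
    is_multistar c -> (forall v, v \in rays c -> degree v <= k) ->
  #|edge H| <= k * #|rays c|.
Proof.
move=> [_ nl _ _] deg.
rewrite mulnC -sum_nat_const.
apply: (@leq_trans (\sum_(v in rays c) degree v)); last exact: leq_sum.
rewrite /degree /sdegree exchange_big /= -sum1_card.
rewrite [X in _ <= X](eq_bigl predT); last by move=> e; rewrite !inE.
apply: leq_sum => e _; have := nl e; rewrite /is_loop => ne12.
have [e1c|e1c] := eqVneq (end1 e) c.
  rewrite (bigD1 (end2 e)) ?eqxx ?addn1 ?addSn //.
  by rewrite !inE -e1c eq_sym.
by rewrite (bigD1 (end1 e)) ?eqxx //= !inE.
Qed.

Lemma multistar_ray_edge (H : mgraph) (c v : H) :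
  is_multistar c -> v \in rays c -> exists e : edge H, incident v e.
Proof.
move=> [[_ conH] _ _ _]; rewrite !inE => vc.
have := conH v c (in_setT _) (in_setT _).
case/connectP=> -[/= _ cv|u p /= /andP[/existsP[e /andP[_ h]] _ _]].
  by rewrite -cv eqxx in vc.
by exists e; rewrite /incident; case/orP: h => /andP[-> _]; rewrite ?orbT.
Qed.

Lemma multistar_incident (H : mgraph) (c u v : H) (e : edge H) :
    is_multistar c -> u \in rays c -> v \in rays c ->
  incident u e -> incident v e -> u = v.
Proof.
move=> [_ _ _ ic]; rewrite !inE => uc vc; have := ic e; rewrite /incident.
move=> /orP[]/eqP ce /orP[]/eqP ue /orP[]/eqP ve;
  by [rewrite ue ve | rewrite ue -ce eqxx in uc | rewrite ve -ce eqxx in vc].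
Qed.

(** The factor [k] turns edges into rays, and [2 * 256 ^ k] is the loss in the colouring. The bound
    follows from [256 <= 3 ^ 8], [3 <= 2 * k + 1] and [2 * k <= k ^ 2 * (k + 1)]. *)
Lemma dk_ge k : 0 < k -> k * (2 * 256 ^ k) <= dk k.
Proof.
move=> k0; rewrite /dk -mulnA mulnC mulnAC mulnC.
apply: leq_mul; last by rewrite mulnC expnS expn1 -mulnA leq_mul2l; nia.
apply: (@leq_trans (3 ^ (8 * k))); first by rewrite (expnM 3 8) leq_exp2r.
apply: (@leq_trans (3 ^ (8 * k + 4))); first by rewrite leq_exp2l // leq_addr.
by rewrite leq_exp2r ?addn4 //; lia.
Qed.

Theorem theorem2 (k n d : nat) (hk : 3 <= k) (hn : 2 <= n)
    (G H : mgraph) (c : H) (sigma : im_map H G)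
    (hd : dk k * n <= d) (hsys : is_ksystem k d c sigma) :
  exists theta : im_map (star n k) G,
    [/\ is_strong_immersion theta,
        theta (star_center n k) = sigma c
      & im_vert theta @: rays (star_center n k)
          \subset im_vert sigma @: rays c].
Proof.
case: hsys => mH [[inj_s conn_s disj_s inc_s _] strong_s] leE degH kcon.
have k0 : 0 < k by apply: leq_trans hk.
pose T := im_vert sigma @: rays c.
have sT : sigma c \notin T.
  by apply/imsetP => -[v + /inj_s cv]; rewrite -cv !inE eqxx.
have leT : 2 * (256 ^ k * n) <= #|T|.
  rewrite (card_imset _ inj_s) -(leq_pmul2l k0).
  apply: leq_trans (multistar_card_edges mH degH); apply: leq_trans leE.
  by apply: leq_trans hd; rewrite !mulnA leq_mul2r -mulnA dk_ge ?orbT.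
(* One edge of [H] is chosen at each ray; outside [T] the value [full G] is a dummy. *)
have spoke_ex (t : G) : exists D : subgraph G, t \in T -> exists v e,
    [/\ v \in rays c, t = sigma v, incident v e & D = im_edge sigma e].
  have [/imsetP[v vc ->]|_] := boolP (t \in T); last by exists (full G).
  have [e ve] := multistar_ray_edge mH vc.
  by exists (im_edge sigma e) => _; exists v, e.
have [C CP] := fin_all_exists spoke_ex.
have [||||||A [sAT leA hA]] :=
    @exists_hall_subset G k (sigma c) T C k0 _ _ _ _ _ _ n leT.
- by move=> t /CP[v [e [_ _ _ ->]]].
- move=> t /CP[v [e [_ _ _ ->]]]; apply: inc_s.
  by have [_ _ _] := mH; apply.
- by move=> t /CP[v [e [_ -> ve ->]]]; apply: inc_s.
- move=> t u /CP[v [e [vc -> ve ->]]] /imsetP[v' v'c ->] nv.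
  apply: strong_s; apply: contraNN nv => v'e.
  by rewrite (multistar_incident mH v'c vc v'e ve).
- move=> t u /CP[v [e [vc -> ve ->]]] /CP[v' [e' [v'c -> v'e' ->]]] nv.
  apply: disj_s; apply: contraNneq nv => ee'.
  by rewrite (multistar_incident mH vc v'c ve) // ee'.
- move=> t X /imsetP[v vc ->] vX cX; rewrite leqNgt; apply/negP => ltk.
  case: (kcon v vc); exists (~: X); rewrite !inE negbK; split=> //.
  by rewrite (_ : edge_cut (~: X) = edge_cut X) //; apply/setP => e;
    rewrite !inE; do 2![case: (_ \in X)].
have [|theta [th1 th2 th3]] :=
    @star_immersion_of_hall G k n (sigma c) A _ leA hA.
  by apply: contra sT; apply: (subsetP sAT).
by exists theta; split=> //; apply: subset_trans sAT.
Qed.
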